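(* Let $A,B$ be rings, ${}_AN_B$ and ${}_BM_A$ bimodules, and let $\Lambda_{(0,0)}=\begin{pmatrix}A & N\\ M & B\end{pmatrix}$ be the Morita ring with zero bimodule homomorphisms, assumed to be an Artin algebra. Assume: (i) the functor $M\otimes_A-\colon\mathrm{mod}\,A\to\mathrm{mod}\,B$ sends acyclic complexes of projective $A$-modules to acyclic complexes of $B$-modules; (ii) $\mathrm{add}({}_AN)\subseteq(\mathrm{Gproj}\,A)^\perp$; (iii) the functor $N\otimes_B-\colon\mathrm{mod}\,B\to\mathrm{mod}\,A$ sends acyclic complexes of projective $B$-modules to acyclic complexes of $A$-modules; (iv) $\mathrm{add}({}_BM)\subseteq(\mathrm{Gproj}\,B)^\perp$. $(\alpha)$ Assume there is a Gorenstein-projective $B$-module $Z$ with a monomorphism $s\colon N\otimes_BZ\to X$, for some $A$-module $X$, such that $\mathrm{Coker}\,s\in\mathrm{Gproj}\,A$, and that there is a monomorphism $t\colon M\otimes_A\mathrm{Coker}\,s\to Y$ with $\mathrm{Coker}\,t=Z$, for some $B$-module $Y$. Let $\pi_X\colon X\to\mathrm{Coker}\,s$ and $\pi_Y\colon Y\to\mathrm{Coker}\,t$ be the projections. Then $(X,Y,f,g)$ is a Gorenstein-projective $\Lambda_{(0,0)}$-module, where $f$ is the composite $M\otimes_AX\xrightarrow{\mathrm{Id}_M\otimes\pi_X}M\otimes_A\mathrm{Coker}\,s\xrightarrow{t}Y$ and $g$ is the composite $N\otimes_BY\xrightarrow{\mathrm{Id}_N\otimes\pi_Y}N\otimes_BZ\xrightarrow{s}X$.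 $(\beta)$ Assume there is a Gorenstein-projective $A$-module $Z$ with a monomorphism $t\colon M\otimes_AZ\to Y$, for some $B$-module $Y$, such that $\mathrm{Coker}\,t\in\mathrm{Gproj}\,B$, and that there is a monomorphism $s\colon N\otimes_B\mathrm{Coker}\,t\to X$ with $\mathrm{Coker}\,s=Z$, for some $A$-module $X$. Let $\pi_X\colon X\to\mathrm{Coker}\,s$ and $\pi_Y\colon Y\to\mathrm{Coker}\,t$ be the projections. Then $(X,Y,f,g)$ is a Gorenstein-projective $\Lambda_{(0,0)}$-module, where $f$ is the composite $M\otimes_AX\xrightarrow{\mathrm{Id}_M\otimes\pi_X}M\otimes_AZ\xrightarrow{t}Y$ and $g$ is the composite $N\otimes_BY\xrightarrow{\mathrm{Id}_N\otimes\pi_Y}N\otimes_B\mathrm{Coker}\,t\xrightarrow{s}X$.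
   Context: $\Lambda_{(0,0)}=A\oplus N\oplus M\oplus B$ as an abelian group, written as $2\times2$ matrices, with multiplication $\begin{pmatrix}a & n\\ m & b\end{pmatrix}\begin{pmatrix}a' & n'\\ m' & b'\end{pmatrix}=\begin{pmatrix}aa' & an'+nb'\\ ma'+bm' & bb'\end{pmatrix}$. It is an Artin algebra iff there is a commutative artinian ring $R$ such that $A,B$ are Artin $R$-algebras and $M,N$ are finitely generated over $R$, with $R$ acting centrally on $M$ and $N$. Modules are finitely generated left modules, forming the category $\mathrm{mod}$. $\Lambda_{(0,0)}$-modules are identified with tuples $(X,Y,f,g)$, where $X$ is an $A$-module, $Y$ a $B$-module, $f\colon M\otimes_AX\to Y$ a $B$-map and $g\colon N\otimes_BY\to X$ an $A$-map such that the composites $N\otimes_BM\otimes_AX\xrightarrow{\mathrm{Id}_N\otimes f}N\otimes_BY\xrightarrow{g}X$ and $M\otimes_AN\otimes_BY\xrightarrow{\mathrm{Id}_M\otimes g}M\otimes_AX\xrightarrow{f}Y$ are zero; the underlying group is $X\oplus Y$ with action $\begin{pmatrix}a & n\\ m & b\end{pmatrix}(x,y)=(ax+g(n\otimes y),by+f(m\otimes x))$. For an Artin algebra $\Lambda$: an acyclic complex $P^\bullet$ of finitely generated projective $\Lambda$-modules is totally acyclic if $\mathrm{Hom}_\Lambda(P^\bullet,\Lambda)$ is acyclic; a module is Gorenstein-projective if it is $\mathrm{Coker}(P^{-1}\to P^0)$ for some totally acyclic $P^\bullet$; $\mathrm{Gproj}\,\Lambda$ is the category of finitely generated Gorenstein-projective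 modules; $(\mathrm{Gproj}\,\Lambda)^\perp=\{X\in\mathrm{mod}\,\Lambda\mid\mathrm{Ext}^1_\Lambda(G,X)=0\ \forall G\in\mathrm{Gproj}\,\Lambda\}$; $\mathrm{add}\,X$ is the category of direct summands of finite direct sums of copies of $X$. *)

(* Defs.v *)
From HB Require Import structures.
From mathcomp Require Import all_boot all_algebra.
From mathcomp Require Import boolp.

Set Implicit Arguments.
Unset Strict Implicit.
Unset Printing Implicit Defensive.

Import GRing.Theory.
Local Open Scope ring_scope.
Local Open Scope quotient_scope.

(* [bimodType A B] : left A-, right B-bimodules, [ract n b] being n.b *)
HB.mixin Record Lmodule_isBimodule (A B : pzRingType) N of GRing.Lmodule A N := {
  ract : N -> B -> N;
  ractDl : forall b, {morph ract^~ b : n n' / n + n'};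
  ractDr : forall n, {morph ract n : b b' / b + b'};
  ractA : forall n b b', ract n (b * b') = ract (ract n b) b';
  ract1 : forall n, ract n 1 = n;
  scale_ract : forall (a : A) n b, a *: ract n b = ract (a *: n) b
}.

#[short(type="bimodType")]
HB.structure Definition Bimodule (A B : pzRingType) :=
  {N of GRing.Lmodule A N & Lmodule_isBimodule A B N}.

Lemma ract0l (C D : pzRingType) (K : bimodType C D) (d : D) : ract (0 : K) d = 0.
Proof. by apply: (addIr (ract 0 d)); rewrite -ractDl !add0r. Qed.
Lemma ract0r (C D : pzRingType) (K : bimodType C D) (k : K) : ract k (0 : D) = 0.
Proof. by apply: (addIr (ract k 0)); rewrite -ractDr !add0r. Qed.

Definition isomorphic (R : pzRingType) (U V : lmodType R) : Prop :=
  exists e : {linear U -> V}, bijective e.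

Definition fin_gen (R : pzRingType) (X : lmodType R) : Prop :=
  exists (n : nat) (e : 'I_n -> X),
    forall x, exists c : 'I_n -> R, x = \sum_(i < n) c i *: e i.

Definition projective (R : pzRingType) (P : lmodType R) : Prop :=
  forall (U V : lmodType R) (p : {linear U -> V}) (h : {linear P -> V}),
    (forall v, exists u, p u = v) ->
    exists k : {linear P -> U}, forall x, p (k x) = h x.

Section Cokernel.
Variables (R : pzRingType) (U V : lmodType R) (s : {linear U -> V}).

Definition im_pred : {pred V} := fun v => `[< exists u, s u = v >].

Lemma im_predP v : reflect (exists u, s u = v) (v \in im_pred).
Proof. exact: asboolP. Qed.

Lemma im_pred_zmod_closed : zmod_closed im_pred.
Proof.
split=> [|x y /im_predP[u <-] /im_predP[w <-]]; apply/im_predP.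
  by exists 0; rewrite linear0.
by exists (u - w); rewrite linearB.
Qed.
HB.instance Definition _ := GRing.isZmodClosed.Build V im_pred im_pred_zmod_closed.

Definition coker : Type := Quotient.quot (im_pred : zmodClosed V).
HB.instance Definition _ := GRing.Zmodule.on coker.

Definition coker_pi (v : V) : coker := \pi_(Quotient.quot (im_pred : zmodClosed V)) v.

Lemma coker_piE v w : coker_pi v = coker_pi w <-> exists u, s u = v - w.
Proof.
rewrite /coker_pi; split=> [/eqP|].
  by rewrite -Quotient.idealrBE => /im_predP.
by move=> /im_predP; rewrite Quotient.idealrBE => /eqP.
Qed.

Lemma coker_piD : {morph coker_pi : x y / x + y}.
Proof. by move=> x y; rewrite /coker_pi raddfD. Qed.

Definition coker_repr (c : coker) : V := repr (c : Quotient.quot (im_pred : zmodClosed V)).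

Lemma coker_reprK : cancel coker_repr coker_pi.
Proof. by move=> c; apply: reprK. Qed.

Definition coker_scale (r : R) (c : coker) : coker := coker_pi (r *: coker_repr c).

Lemma coker_piZ r v : coker_pi (r *: v) = coker_scale r (coker_pi v).
Proof.
have /coker_piE[u su] : coker_pi v = coker_pi (coker_repr (coker_pi v)).
  by rewrite coker_reprK.
by apply/coker_piE; exists (r *: u); rewrite linearZ /= su scalerBr.
Qed.

Lemma coker_scaleA a b c : coker_scale a (coker_scale b c) = coker_scale (a * b) c.
Proof. by rewrite -[c]coker_reprK -!coker_piZ scalerA. Qed.
Lemma coker_scale1 : left_id 1 coker_scale.
Proof. by move=> c; rewrite -[c]coker_reprK -coker_piZ scale1r. Qed.
Lemma coker_scaleDr : right_distributive coker_scale +%R.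
Proof.
move=> a c d; rewrite -[c]coker_reprK -[d]coker_reprK.
by rewrite -coker_piD -!coker_piZ -coker_piD scalerDr.
Qed.
Lemma coker_scaleDl c : {morph coker_scale^~ c : a b / a + b}.
Proof.
by move=> a b; rewrite -[c]coker_reprK -!coker_piZ -coker_piD scalerDl.
Qed.
HB.instance Definition _ := GRing.Zmodule_isLmodule.Build R coker
  coker_scaleA coker_scale1 coker_scaleDr coker_scaleDl.

Lemma coker_pi_linear : linear coker_pi.
Proof. by move=> a x y; rewrite coker_piD coker_piZ. Qed.
HB.instance Definition _ := GRing.isLinear.Build R V coker *:%R coker_pi coker_pi_linear.

End Cokernel.
Arguments coker {R U V} s.
Arguments coker_pi {R U V} s v.

(* The tensor product of a (B,A)-bimodule M with a left A-module X, presented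
   as the commutative monoid of finite formal sums of pairs (m, x) modulo the
   defining relations; it is a group because (m, x) + (- m, x) ~ (0, x) ~ 0. *)
Section Tensor.
Variables (B A : pzRingType) (M : bimodType B A) (X : lmodType A).

Inductive tens_rel : seq (M * X) -> seq (M * X) -> Prop :=
| tens_refl u : tens_rel u u
| tens_sym u v : tens_rel u v -> tens_rel v u
| tens_trans u v w : tens_rel u v -> tens_rel v w -> tens_rel u w
| tens_cat u u' v v' :
    tens_rel u u' -> tens_rel v v' -> tens_rel (u ++ v) (u' ++ v')
| tens_catC u v : tens_rel (u ++ v) (v ++ u)
| tens_0l x : tens_rel [:: (0, x)] [::]
| tens_Dl m m' x : tens_rel [:: (m + m', x)] [:: (m, x); (m', x)]
| tens_Dr m x x' : tens_rel [:: (m, x + x')] [:: (m, x); (m, x')]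
| tens_bal m (a : A) x : tens_rel [:: (ract m a, x)] [:: (m, a *: x)].

Definition tens_eqb (u v : seq (M * X)) : bool := `[< tens_rel u v >].

Lemma tens_eqb_class : equiv_class_of tens_eqb.
Proof.
split=> [u|u v|v u w]; first by apply/asboolP/tens_refl.
  by apply/asboolP/asboolP; apply: tens_sym.
by move=> /asboolP uv /asboolP vw; apply/asboolP/(tens_trans uv vw).
Qed.

Canonical tens_equiv := EquivRelPack tens_eqb_class.
Canonical tens_encModRel := defaultEncModRel tens_eqb.

Definition tensor : Type := {eq_quot tens_eqb}.
HB.instance Definition _ := Choice.on tensor.

Definition tens_pi (u : seq (M * X)) : tensor := \pi_({eq_quot tens_eqb}) u.
Definition tens_repr (z : tensor) : seq (M * X) := repr (z : {eq_quot tens_eqb}).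
Definition tens (m : M) (x : X) : tensor := tens_pi [:: (m, x)].

Lemma tens_reprK : cancel tens_repr tens_pi.
Proof. by move=> z; apply: reprK. Qed.

Lemma tens_piE u v : tens_pi u = tens_pi v <-> tens_rel u v.
Proof.
by split=> [/eqP|uv]; [rewrite eqmodE => /asboolP | apply/eqP; rewrite eqmodE; apply/asboolP].
Qed.

Lemma tens_repr_pi u : tens_rel (tens_repr (tens_pi u)) u.
Proof. by apply/tens_piE; rewrite tens_reprK. Qed.

Definition tens_opp_seq (u : seq (M * X)) := [seq (- p.1, p.2) | p <- u].
Definition tens_scale_seq (b : B) (u : seq (M * X)) := [seq (b *: p.1, p.2) | p <- u].

Definition tens_zero : tensor := tens_pi [::].
Definition tens_add (y z : tensor) : tensor := tens_pi (tens_repr y ++ tens_repr z).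
Definition tens_opp (z : tensor) : tensor := tens_pi (tens_opp_seq (tens_repr z)).
Definition tens_scale (b : B) (z : tensor) : tensor :=
  tens_pi (tens_scale_seq b (tens_repr z)).

Lemma tens_opp_rel u v : tens_rel u v -> tens_rel (tens_opp_seq u) (tens_opp_seq v).
Proof.
elim=> {u v} [u|u v _|u v w _ uv _ vw|u u' v v' _ uu' _ vv'|u v|x|m m' x|m x x'|m a x].
- exact: tens_refl.
- exact: tens_sym.
- exact: tens_trans vw.
- by rewrite /tens_opp_seq !map_cat; apply: tens_cat.
- by rewrite /tens_opp_seq !map_cat; apply: tens_catC.
- by rewrite /= oppr0; apply: tens_0l.
- by rewrite /= opprD; apply: tens_Dl.
- exact: tens_Dr.
rewrite /=; have -> : - ract m a = ract (- m) a; last exact: tens_bal.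
by apply: (addIr (ract m a)); rewrite addNr -ractDl addNr ract0l.
Qed.

Lemma tens_scale_rel b u v :
  tens_rel u v -> tens_rel (tens_scale_seq b u) (tens_scale_seq b v).
Proof.
elim=> {u v} [u|u v _|u v w _ uv _ vw|u u' v v' _ uu' _ vv'|u v|x|m m' x|m x x'|m a x].
- exact: tens_refl.
- exact: tens_sym.
- exact: tens_trans vw.
- by rewrite /tens_scale_seq !map_cat; apply: tens_cat.
- by rewrite /tens_scale_seq !map_cat; apply: tens_catC.
- by rewrite /= scaler0; apply: tens_0l.
- by rewrite /= scalerDr; apply: tens_Dl.
- exact: tens_Dr.
by rewrite /= scale_ract; apply: tens_bal.
Qed.

Lemma tens_piD u v : tens_pi (u ++ v) = tens_add (tens_pi u) (tens_pi v).
Proof. by apply/tens_piE/tens_cat; apply/tens_sym/tens_repr_pi. Qed.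
Lemma tens_piN u : tens_pi (tens_opp_seq u) = tens_opp (tens_pi u).
Proof. by apply/tens_piE/tens_opp_rel/tens_sym/tens_repr_pi. Qed.
Lemma tens_piZ b u : tens_pi (tens_scale_seq b u) = tens_scale b (tens_pi u).
Proof. by apply/tens_piE/tens_scale_rel/tens_sym/tens_repr_pi. Qed.

Lemma tens_addA : associative tens_add.
Proof.
move=> x y z; rewrite -[x]tens_reprK -[y]tens_reprK -[z]tens_reprK.
by rewrite -!tens_piD catA.
Qed.
Lemma tens_addC : commutative tens_add.
Proof.
move=> x y; rewrite -[x]tens_reprK -[y]tens_reprK -!tens_piD.
exact/tens_piE/tens_catC.
Qed.
Lemma tens_add0 : left_id tens_zero tens_add.
Proof. by move=> x; rewrite -[x]tens_reprK -tens_piD. Qed.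
Lemma tens_addN : left_inverse tens_zero tens_opp tens_add.
Proof.
move=> z; rewrite -[z]tens_reprK -tens_piN -tens_piD; apply/tens_piE.
elim: (tens_repr z) => [|[m x] u IHu] /=; first exact: tens_refl.
rewrite -cat1s -[(m, x) :: u]cat1s.
apply: (@tens_trans _ ([:: (- m, x)] ++ [:: (m, x)] ++ (tens_opp_seq u ++ u))).
  apply: tens_cat; first exact: tens_refl.
  rewrite !catA; apply: tens_cat; [exact: tens_catC | exact: tens_refl].
rewrite catA -[[::]]/([::] ++ [::]); apply: tens_cat => //.
apply: (@tens_trans _ [:: (- m + m, x)]); first exact/tens_sym/tens_Dl.
by rewrite addNr; apply: tens_0l.
Qed.
HB.instance Definition _ :=
  GRing.isZmodule.Build tensor tens_addA tens_addC tens_add0 tens_addN.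

Lemma tens_pi_cat u v : tens_pi (u ++ v) = tens_pi u + tens_pi v.
Proof. exact: tens_piD. Qed.

Lemma tens_scaleA a b z : tens_scale a (tens_scale b z) = tens_scale (a * b) z.
Proof.
rewrite -[z]tens_reprK -!tens_piZ /tens_scale_seq -map_comp.
by congr tens_pi; apply: eq_map => -[m x] /=; rewrite scalerA.
Qed.
Lemma tens_scale1 : left_id 1 tens_scale.
Proof.
move=> z; rewrite -[z]tens_reprK -tens_piZ /tens_scale_seq.
by congr tens_pi; rewrite -[RHS]map_id; apply: eq_map => -[m x] /=; rewrite scale1r.
Qed.
Lemma tens_scaleDr : right_distributive tens_scale +%R.
Proof.
move=> b y z; rewrite -[y]tens_reprK -[z]tens_reprK.
by rewrite -[in LHS]tens_pi_cat -!tens_piZ /tens_scale_seq map_cat tens_pi_cat.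
Qed.
Lemma tens_scaleDl z : {morph tens_scale^~ z : a b / a + b}.
Proof.
move=> a b; rewrite -[z]tens_reprK -!tens_piZ.
rewrite -[RHS]tens_pi_cat; apply/tens_piE.
elim: (tens_repr z) => [|[m x] u IHu] /=; first exact: tens_refl.
rewrite -cat1s -[_ :: tens_scale_seq b u]cat1s.
apply: (@tens_trans _ ([:: (a *: m, x); (b *: m, x)]
                        ++ (tens_scale_seq a u ++ tens_scale_seq b u))).
  by apply: tens_cat => //; rewrite scalerDl; apply: tens_Dl.
rewrite -cat1s -[_ :: tens_scale_seq a u ++ _]cat1s -catA.
apply: tens_cat; first exact: tens_refl.
rewrite !catA; apply: tens_cat; [exact: tens_catC | exact: tens_refl].
Qed.
HB.instance Definition _ := GRing.Zmodule_isLmodule.Build B tensor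
  tens_scaleA tens_scale1 tens_scaleDr tens_scaleDl.

Lemma tens_pi_scale b u : tens_pi (tens_scale_seq b u) = b *: tens_pi u.
Proof. exact: tens_piZ. Qed.

End Tensor.
Arguments tensor {B A} M X.
Arguments tens {B A M X} m x.

Lemma tens_ind (B A : pzRingType) (M : bimodType B A) (X : lmodType A)
    (K : tensor M X -> Prop) :
  K 0 -> (forall m x z, K z -> K (tens m x + z)) -> forall z, K z.
Proof.
move=> K0 KD z; rewrite -[z]tens_reprK.
elim: (tens_repr z) => [//|[m x] u IHu].
by rewrite -cat1s tens_pi_cat; apply: KD.
Qed.

Section TensorBilinear.
Variables (B A : pzRingType) (M : bimodType B A) (X : lmodType A).
Implicit Types (m : M) (x : X).

Lemma tensDl m m' x : tens (m + m') x = tens m x + tens m' x.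
Proof. by rewrite -[RHS]tens_pi_cat; apply/tens_piE/tens_Dl. Qed.
Lemma tensDr m x x' : tens m (x + x') = tens m x + tens m x'.
Proof. by rewrite -[RHS]tens_pi_cat; apply/tens_piE/tens_Dr. Qed.
Lemma tens_balanced m (a : A) x : tens (ract m a) x = tens m (a *: x).
Proof. exact/tens_piE/tens_bal. Qed.
Lemma tensZl (b : B) m x : tens (b *: m) x = b *: tens m x.
Proof. by rewrite -[RHS]tens_pi_scale. Qed.

Lemma tens_univ (V : lmodType B) (phi : M -> X -> V) :
  (forall x, linear (phi^~ x)) -> (forall m, {morph phi m : x x' / x + x'}) ->
  (forall m (a : A) x, phi (ract m a) x = phi m (a *: x)) ->
  exists h : {linear tensor M X -> V}, (forall m x, h (tens m x) = phi m x) /\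
    forall k : {linear tensor M X -> V}, (forall m x, k (tens m x) = phi m x) -> h =1 k.
Proof.
move=> phiP phiDr phiA.
pose F (u : seq (M * X)) := \sum_(p <- u) phi p.1 p.2.
have phiDl m m' x : phi (m + m') x = phi m x + phi m' x.
  by rewrite -{1}[m]scale1r phiP scale1r.
have phi0 x : phi 0 x = 0 by apply: (addIr (phi 0 x)); rewrite -phiDl !add0r.
have phiZ b m x : phi (b *: m) x = b *: phi m x.
  by rewrite -[b *: m]addr0 phiP phi0 addr0.
have F_rel u v : tens_rel u v -> F u = F v.
  rewrite /F; elim=> {u v} // [u v w _ -> _ ->|u u' v v' _ + _|u v|x|m m' x|m x x'|m a x] //.
  - by rewrite !big_cat => -> /= ->.
  - by rewrite !big_cat /= addrC.
  - by rewrite big_seq1 big_nil.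
  - by rewrite !big_cons !big_nil !addr0 phiDl.
  - by rewrite !big_cons !big_nil !addr0 phiDr.
  - by rewrite !big_seq1 phiA.
pose h (z : tensor M X) := F (tens_repr z).
have hE u : h (tens_pi u) = F u by apply/F_rel/tens_repr_pi.
have h_lin : linear h.
  move=> b y z; rewrite -[y]tens_reprK -[z]tens_reprK.
  rewrite -tens_pi_scale -tens_pi_cat !hE /F big_cat big_map /= scaler_sumr.
  by congr (_ + _); apply: eq_bigr => p _; rewrite phiZ.
pose hL := HB.pack_for {linear tensor M X -> V} h
  (GRing.isLinear.Build B (tensor M X) V *:%R h h_lin).
exists hL; split=> [m x|k kE]; first by rewrite /= /tens hE /F big_seq1.
elim/tens_ind=> [|m x z IHz]; first by rewrite !linear0.
by rewrite !linearD IHz kE /= /tens hE /F big_seq1.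
Qed.

End TensorBilinear.

(* [tmap M h] is Id_M (x) h *)
Section TensorMap.
Variables (B A : pzRingType) (M : bimodType B A) (X X' : lmodType A).
Variable h : {linear X -> X'}.

Definition tmap_seq (u : seq (M * X)) : seq (M * X') := [seq (p.1, h p.2) | p <- u].

Lemma tmap_rel u v : tens_rel u v -> tens_rel (tmap_seq u) (tmap_seq v).
Proof.
elim=> {u v} [u|u v _|u v w _ uv _ vw|u u' v v' _ uu' _ vv'|u v|x|m m' x|m x x'|m a x].
- exact: tens_refl.
- exact: tens_sym.
- exact: tens_trans vw.
- by rewrite /tmap_seq !map_cat; apply: tens_cat.
- by rewrite /tmap_seq !map_cat; apply: tens_catC.
- exact: tens_0l.
- exact: tens_Dl.
- by rewrite /= linearD; apply: tens_Dr.
by rewrite /= linearZ; apply: tens_bal.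
Qed.

Definition tmap (z : tensor M X) : tensor M X' := tens_pi (tmap_seq (tens_repr z)).

Lemma tmap_pi u : tmap (tens_pi u) = tens_pi (tmap_seq u).
Proof. exact/tens_piE/tmap_rel/tens_repr_pi. Qed.

Lemma tmap_linear : linear tmap.
Proof.
move=> b y z; rewrite -[y]tens_reprK -[z]tens_reprK.
rewrite -[in LHS]tens_pi_scale -[in LHS]tens_pi_cat !tmap_pi.
rewrite -[in RHS]tens_pi_scale -[in RHS]tens_pi_cat.
by rewrite /tmap_seq map_cat /tens_scale_seq -!map_comp.
Qed.
HB.instance Definition _ :=
  GRing.isLinear.Build B (tensor M X) (tensor M X') *:%R tmap tmap_linear.

Lemma tmapE m x : tmap (tens m x) = tens m (h x).
Proof. exact: tmap_pi. Qed.

End TensorMap.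
Arguments tmap {B A} M {X X'} h z.

Record complex (R : pzRingType) := Complex {
  obj :> int -> lmodType R;
  diff : forall i, {linear obj i -> obj (i + 1)};
  diff_diff : forall i x, diff (i + 1) (diff i x) = 0
}.
Arguments diff {R} c i.

Definition acyclic (R : pzRingType) (P : complex R) : Prop :=
  forall i (x : P (i + 1)), diff P (i + 1) x = 0 -> exists y, diff P i y = x.

(* complexes in proj R, the finitely generated projective modules *)
Definition complex_proj (R : pzRingType) (P : complex R) : Prop :=
  forall i, fin_gen (P i) /\ projective (P i).

(* acyclicity of Hom_R(P, X), whose differentials are precomposition with those of P *)
Definition hom_acyclic (R : pzRingType) (P : complex R) (X : lmodType R) : Prop :=
  forall i (phi : {linear P (i + 1) -> X}),
    (forall x, phi (diff P i x) = 0) ->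
    exists psi : {linear P (i + 1 + 1) -> X}, forall x, psi (diff P (i + 1) x) = phi x.

Definition totally_acyclic (R : pzRingType) (P : complex R) : Prop :=
  [/\ complex_proj P, acyclic P & hom_acyclic P R^o].

(* Such a module is automatically finitely generated, so this is also
   membership in Gproj R. *)
Definition gproj (R : pzRingType) (G : lmodType R) : Prop :=
  exists P : complex R, totally_acyclic P /\ isomorphic (coker (diff P (- 1))) G.

Record proj_resolution (R : pzRingType) (G : lmodType R) := ProjResolution {
  res_obj :> nat -> lmodType R;
  res_diff : forall n, {linear res_obj n.+1 -> res_obj n};
  res_aug : {linear res_obj 0%N -> G};
  res_proj : forall n, projective (res_obj n);
  res_aug_surj : forall x, exists y, res_aug y = x;
  res_exact0 : forall x, res_aug x = 0 <-> exists y, res_diff 0%N y = x;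
  res_exact : forall n x, res_diff n x = 0 <-> exists y, res_diff n.+1 y = x
}.
Arguments res_diff {R G} p n.

(* Ext^1_R(G, X) = H^1(Hom_R(P, X)) = 0, P a projective resolution of G;
   H^1 does not depend on P, and every module has a projective resolution. *)
Definition ext1_zero (R : pzRingType) (G X : lmodType R) : Prop :=
  forall (P : proj_resolution G) (phi : {linear P 1%N -> X}),
    (forall x, phi (res_diff P 1%N x) = 0) ->
    exists psi : {linear P 0%N -> X}, forall x, psi (res_diff P 0%N x) = phi x.

Definition gproj_perp (R : pzRingType) (X : lmodType R) : Prop :=
  fin_gen X /\ forall G : lmodType R, gproj G -> ext1_zero G X.

Definition in_add (R : pzRingType) (X W : lmodType R) : Prop :=
  exists (n : nat) (W' : lmodType R),
    isomorphic (W * W')%type {ffun 'I_n -> X}.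

Section TensorComplex.
Variables (B A : pzRingType) (M : bimodType B A) (P : complex A).

Lemma tmap_diff_diff i (z : tensor M (P i)) :
  tmap M (diff P (i + 1)) (tmap M (diff P i) z) = 0.
Proof.
elim/tens_ind: z => [|m x z IHz]; first by rewrite !linear0.
rewrite !linearD /= IHz addr0 !tmapE diff_diff.
by apply: (addIr (tens m (0 : P (i + 1 + 1)))); rewrite -tensDr !add0r.
Qed.

Definition tensor_complex : complex B :=
  @Complex B (fun i => tensor M (P i)) (fun i => tmap M (diff P i)) tmap_diff_diff.

End TensorComplex.
Arguments tensor_complex {B A} M P.

Definition tensor_preserves_acyclic (B A : pzRingType) (M : bimodType B A) : Prop :=
  forall P : complex A, complex_proj P -> acyclic P -> acyclic (tensor_complex M P).

Definition is_ideal (R : comPzRingType) (I : R -> Prop) : Prop :=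
  [/\ I 0, forall x y, I x -> I y -> I (x + y) & forall r x, I x -> I (r * x)].

Definition artinian (R : comPzRingType) : Prop :=
  forall I : nat -> R -> Prop, (forall n, is_ideal (I n)) ->
    (forall n x, I n.+1 x -> I n x) ->
    exists n, forall m, (n <= m)%N -> forall x, I n x -> I m x.

Definition artin_algebra (L : pzRingType) : Prop :=
  exists (R : comPzRingType) (phi : {rmorphism R -> L}),
    [/\ artinian R,
        forall r x, phi r * x = x * phi r
      & exists (n : nat) (e : 'I_n -> L),
          forall x, exists c : 'I_n -> R, x = \sum_(i < n) phi (c i) * e i].

Section MoritaRing.
Variables (A B : pzRingType) (N : bimodType A B) (M : bimodType B A).

(* (a, n, m, b) stands for the 2x2 matrix with rows (a, n) and (m, b) *)
Definition morita : Type := (A * N * M * B)%type.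
HB.instance Definition _ := GRing.Zmodule.on morita.

Definition morita_one : morita := (1, 0, 0, 1).
Definition morita_mul (u v : morita) : morita :=
  let: (a, n, m, b) := u in let: (a', n', m', b') := v in
  (a * a', a *: n' + ract n b', ract m a' + b *: m', b * b').

Lemma morita_mulA : associative morita_mul.
Proof.
move=> [[[a n] m] b] [[[a' n'] m'] b'] [[[a'' n''] m''] b''] /=.
rewrite !mulrA !scalerDr !ractDl !scalerA !ractA !scale_ract !addrA.
by [].
Qed.
Lemma morita_mul1l : left_id morita_one morita_mul.
Proof.
by move=> [[[a n] m] b]; rewrite /= !mul1r !scale1r !ract0l addr0 add0r.
Qed.
Lemma morita_mul1r : right_id morita_one morita_mul.
Proof.
by move=> [[[a n] m] b]; rewrite /= !mulr1 !scaler0 !ract1 addr0 add0r.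
Qed.
Lemma morita_mulDl : left_distributive morita_mul +%R.
Proof.
move=> [[[a n] m] b] [[[a' n'] m'] b'] [[[a'' n''] m''] b''] /=.
rewrite /GRing.add /= /add_pair /=.
rewrite !mulrDl !scalerDl !ractDl.
by congr (_, _, _, _); rewrite addrACA.
Qed.
Lemma morita_mulDr : right_distributive morita_mul +%R.
Proof.
move=> [[[a n] m] b] [[[a' n'] m'] b'] [[[a'' n''] m''] b''] /=.
rewrite /GRing.add /= /add_pair /=.
rewrite !mulrDr !scalerDr !ractDr.
by congr (_, _, _, _); rewrite addrACA.
Qed.
HB.instance Definition _ := GRing.Zmodule_isPzRing.Build morita
  morita_mulA morita_mul1l morita_mul1r morita_mulDl morita_mulDr.

End MoritaRing.

Section MoritaModule.
Variables (A B : pzRingType) (N : bimodType A B) (M : bimodType B A).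
Variables (X : lmodType A) (Y : lmodType B).
Variables (f : {linear tensor M X -> Y}) (g : {linear tensor N Y -> X}).

Definition morita_compat : Prop :=
  (forall z : tensor N (tensor M X), g (tmap N f z) = 0) /\
  (forall z : tensor M (tensor N Y), f (tmap M g z) = 0).

Definition morita_module (h : morita_compat) : Type := (X * Y)%type.

Variable h : morita_compat.
HB.instance Definition _ := GRing.Zmodule.on (morita_module h).

Definition morita_scale (l : morita N M) (w : morita_module h) : morita_module h :=
  let: (a, n, m, b) := l in let: (x, y) := w in
  (a *: x + g (tens n y), b *: y + f (tens m x)).

Lemma morita_scaleA u v w :
  morita_scale u (morita_scale v w) = morita_scale (u * v) w.
Proof.
case: u v w => [[[a n] m] b] [[[a' n'] m'] b'] [x y].
rewrite /GRing.mul /= !tensDr !tensDl !linearD /=.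
have gf p q r : g (tens p (f (tens q r))) = 0.
  by rewrite -tmapE; case: h => + _; apply.
have fg p q r : f (tens p (g (tens q r))) = 0.
  by rewrite -tmapE; case: h => _; apply.
rewrite gf fg !addr0 !tens_balanced !tensZl !linearZ /= !scalerDr !scalerA.
by congr (_, _); rewrite -!addrA; congr (_ + _); rewrite addrC.
Qed.
Lemma morita_scale1 : left_id 1 morita_scale.
Proof.
move=> [x y]; rewrite /morita_scale /= !scale1r.
have t0 (C D : pzRingType) (K : bimodType C D) (V : lmodType D) (v : V) :
    tens (0 : K) v = 0.
  by apply: (addIr (tens 0 v)); rewrite -tensDl !add0r.
by rewrite !t0 !linear0 !addr0.
Qed.
Lemma morita_scaleDr : right_distributive morita_scale +%R.
Proof.
move=> [[[a n] m] b] [x y] [x' y'].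
rewrite /GRing.add /= /add_pair /= !tensDr !linearD /= !scalerDr.
by congr (_, _); rewrite addrACA.
Qed.
Lemma morita_scaleDl w : {morph morita_scale^~ w : u v / u + v}.
Proof.
case: w => x y [[[a n] m] b] [[[a' n'] m'] b'].
rewrite /GRing.add /= /add_pair /= !tensDl !linearD /= !scalerDl.
by congr (_, _); rewrite addrACA.
Qed.
HB.instance Definition _ := GRing.Zmodule_isLmodule.Build (morita N M)
  (morita_module h) morita_scaleA morita_scale1 morita_scaleDr morita_scaleDl.

End MoritaModule.
Arguments morita {A B} N M.
Arguments morita_compat {A B N M X Y} f g.
Arguments morita_module {A B N M X Y f g} h.

(* Main.v *)
Require Import Defs.
From HB Require Import structures.
From mathcomp Require Import all_boot all_algebra.
From mathcomp Require Import boolp.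

(* Write 0 -> N(x)Z -> X -> W -> 0 and 0 -> M(x)W -> Y -> Z -> 0 for the two given
   extensions; (alpha) and (beta) are both instances of this symmetric situation.
   Let P and Q be totally acyclic complexes with cokernels W and Z. A horseshoe
   argument in both directions, using that N(x)Q is exact and that Hom_A(P, N) is
   acyclic by (ii), yields maps sigma : P^i -> N(x)Q^(i+1) anticommuting with the
   differentials such that the cokernel of the resulting differential on
   P (+) N(x)Q is X; symmetrically one gets tau and Y. Both together
   define a complex T of projective Morita modules
   T^i = (P^i, M(x)P^i, id, 0) (+) (N(x)Q^i, Q^i, 0, id)
   with cokernel (X, Y, f, g). It is exact as an extension of exact complexes, and
   Hom(T, Lambda) is acyclic because Lambda is an extension of (A, 0) (+) (0, B)
   by (N, 0) (+) (0, M), on which Hom(T, -) is Hom_A(P, -) (+) Hom_B(Q, -). *)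

Set Implicit Arguments.
Unset Strict Implicit.
Unset Printing Implicit Defensive.

Import GRing.Theory.
Local Open Scope ring_scope.

(** * Dual bases of finitely generated projective modules, and cokernels *)

Definition linear_of (R : pzRingType) (U V : lmodType R) (f : U -> V)
    (f_lin : linear f) : {linear U -> V} :=
  HB.pack_for {linear U -> V} f (GRing.isLinear.Build R U V *:%R f f_lin).

(** An explicit form of being finitely generated projective: lifts become finite sums, and the data
    can be carried through tensor products. *)
Definition has_dual_basis (R : pzRingType) (P : lmodType R) : Prop :=
  exists (n : nat) (e : 'I_n -> P) (c : 'I_n -> {linear P -> R^o}),
    forall x, x = \sum_(i < n) (c i x : R) *: e i.

(** Projectivity splits the surjection [R^n -> P] given by the generators; the [c i] are the
    coordinates of the splitting. *)
Lemma fg_projective_dual_basis (R : pzRingType) (P : lmodType R) :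
  fin_gen P -> projective P -> has_dual_basis P.
Proof.
move=> [n [e e_gen]] P_proj.
pose p (c : {ffun 'I_n -> R^o}) : P := \sum_(i < n) (c i : R) *: e i.
have p_lin : linear p.
  move=> a c d; rewrite /p scaler_sumr -big_split /=.
  by apply: eq_bigr => i _; rewrite !ffunE scalerDl scalerA.
have id_lin : linear (fun x : P => x) by [].
case: (P_proj _ _ (linear_of p_lin) (linear_of id_lin)) => [x|k kP].
  have [c xE] := e_gen x; exists [ffun i => c i].
  by rewrite /= /p xE; apply: eq_bigr => i _; rewrite ffunE.
have k_lin i : linear (fun x => k x i : R^o).
  by move=> a x y; rewrite linearP !ffunE.
by exists n, e, (fun i => linear_of (k_lin i)) => x; rewrite -[LHS]kP.
Qed.

(** Only the image of [h] has to lie in that of [p], so lifting along an exact complex requires no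
    passage to submodules. The lift sends [x] to the combination of chosen preimages [u i] with
    coordinates [c i x]. *)
Lemma dual_basis_lift (R : pzRingType) (P U V : lmodType R)
    (p : {linear U -> V}) (h : {linear P -> V}) :
  has_dual_basis P -> (forall x, exists u, p u = h x) ->
  exists k : {linear P -> U}, forall x, p (k x) = h x.
Proof.
move=> [n [e [c cE]]] h_im.
have [u uE] := choice (fun i => h_im (e i)).
pose k x := \sum_(i < n) (c i x : R) *: u i.
have k_lin : linear k.
  move=> a x y; rewrite /k scaler_sumr -big_split /=.
  by apply: eq_bigr => i _; rewrite linearP scalerDl scalerA.
exists (linear_of k_lin) => x; rewrite /= /k linear_sum [in RHS](cE x) linear_sum.
by apply: eq_bigr => i _; rewrite !linearZ uE.
Qed.

Lemma dual_basis_projective (R : pzRingType) (P : lmodType R) :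
  has_dual_basis P -> projective P.
Proof. by move=> P_db U V p h p_surj; apply: dual_basis_lift. Qed.

Lemma dual_basis_fin_gen (R : pzRingType) (P : lmodType R) :
  has_dual_basis P -> fin_gen P.
Proof.
by move=> [n [e [c cE]]]; exists n, e => x; exists (fun i => c i x).
Qed.

Lemma coker_pi_surj (R : pzRingType) (U V : lmodType R) (d : {linear U -> V}) c :
  exists v, coker_pi d v = c.
Proof. by exists (coker_repr c); apply: coker_reprK. Qed.

Lemma coker_pi_eq0 (R : pzRingType) (U V : lmodType R) (d : {linear U -> V}) v :
  coker_pi d v = 0 <-> exists u, d u = v.
Proof. by have := coker_piE d v 0; rewrite linear0 subr0. Qed.

Lemma coker_isomorphic (R : pzRingType) (U V G : lmodType R)
    (d : {linear U -> V}) (p : {linear V -> G}) :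
  (forall x, exists v, p v = x) -> (forall v, p v = 0 <-> exists u, d u = v) ->
  isomorphic (coker d) G.
Proof.
move=> p_surj p_ker.
have p_repr v : p (coker_repr (coker_pi d v)) = p v.
  apply/eqP; rewrite -subr_eq0 -linearB; apply/eqP/p_ker/coker_piE.
  by rewrite coker_reprK.
have q_lin : linear (fun c : coker d => p (coker_repr c)).
  move=> a c c'; rewrite -[c]coker_reprK -[c']coker_reprK.
  by rewrite -linearP !p_repr linearP.
have [l lE] := choice p_surj.
exists (linear_of q_lin), (fun x => coker_pi d (l x)) => [c|x] /=.
  rewrite -[RHS]coker_reprK; apply/coker_piE/p_ker.
  by rewrite linearB /= lE subrr.
by rewrite p_repr.
Qed.

(** Replaces the isomorphism with a cokernel by an epimorphism with known kernel, the form in which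
    the extensions below are resolved. *)
Lemma gproj_resolution (R : pzRingType) (G : lmodType R) :
  gproj G -> exists (P : complex R) (p : {linear P (- 1 + 1) -> G}),
    [/\ totally_acyclic P, forall x, exists v, p v = x
      & forall v, p v = 0 <-> exists u, diff P (- 1) u = v].
Proof.
move=> [P [P_tac [h [h' hK h'K]]]]; exists P.
exists (h \o coker_pi (diff P (- 1))); split=> // [x|v] /=.
  by exists (coker_repr (h' x)); rewrite /= coker_reprK h'K.
rewrite -coker_pi_eq0; split=> [hv|->]; last by rewrite linear0.
by apply: (can_inj hK); rewrite hv linear0.
Qed.

(** * Right exactness of the tensor product *)

Section TensorFacts.
Variables (B A : pzRingType) (M : bimodType B A).

Lemma tens0l (X : lmodType A) (x : X) : tens (0 : M) x = 0.
Proof. by apply: (addIr (tens 0 x)); rewrite -tensDl !add0r. Qed.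

Lemma tens0r (X : lmodType A) (m : M) : tens m (0 : X) = 0.
Proof. by apply: (addIr (tens m 0)); rewrite -tensDr !add0r. Qed.

Lemma eq_tensor_linear (X : lmodType A) (V : lmodType B)
    (h k : {linear tensor M X -> V}) :
  (forall m x, h (tens m x) = k (tens m x)) -> h =1 k.
Proof.
move=> hk; elim/tens_ind => [|m x z IHz]; first by rewrite !linear0.
by rewrite !linearD IHz hk.
Qed.

Lemma tmap_comp (X X' X'' : lmodType A) (h : {linear X -> X'})
    (k : {linear X' -> X''}) z :
  tmap M k (tmap M h z) = tmap M (k \o h) z.
Proof.
move: z; apply: (eq_tensor_linear (h := tmap M k \o tmap M h)) => m x /=.
by rewrite !tmapE.
Qed.

Lemma tmap0 (X X' : lmodType A) (h : {linear X -> X'}) :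
  (forall x, h x = 0) -> forall z, tmap M h z = 0.
Proof.
move=> h0; elim/tens_ind => [|m x z IHz]; first by rewrite linear0.
by rewrite linearD /= IHz tmapE h0 tens0r addr0.
Qed.

Lemma tmap_surj (X X' : lmodType A) (h : {linear X -> X'}) :
  (forall x, exists y, h y = x) -> forall z, exists y, tmap M h y = z.
Proof.
move=> h_surj; elim/tens_ind => [|m x _ [y <-]].
  by exists 0; rewrite linear0.
have [x' <-] := h_surj x.
by exists (tens m x' + y); rewrite linearD /= tmapE.
Qed.

(* The inverse of [coker (M (x) d) -> M (x) X''] is built from the universal
   property, sending [m (x) p x] to the class of [m (x) x]. *)
Lemma tmap_right_exact (X X' X'' : lmodType A) (d : {linear X -> X'})
    (p : {linear X' -> X''}) :
  (forall x, exists y, p y = x) -> (forall x, p x = 0 <-> exists y, d y = x) ->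
  forall z, tmap M p z = 0 <-> exists y, tmap M d y = z.
Proof.
move=> p_surj p_ker z; split=> [pz0|[y <-]]; last first.
  by rewrite tmap_comp tmap0 // => x /=; apply/p_ker; exists x.
have [l lE] := choice p_surj.
pose phi (m : M) x := coker_pi (tmap M d) (tens m (l x)).
(* The class is independent of the chosen preimage of [x], since two preimages differ by an element
   of the image of [d]. Additivity and balancedness of [phi] follow. *)
have phiE m x x' : p x' = x -> phi m x = coker_pi (tmap M d) (tens m x').
  move=> px'; apply/coker_piE.
  have /p_ker[y dy] : p (l x - x') = 0 by rewrite linearB /= lE px' subrr.
  exists (tens m y); rewrite /= tmapE dy; apply: (addIr (tens m x')).
  by rewrite -tensDr !subrK.
case: (@tens_univ _ _ M X'' _ phi) => [x b m m'|m x x'|m a x|h [hE _]].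
- by rewrite /phi tensDl tensZl linearP.
- by rewrite (phiE m _ (l x + l x')) ?tensDr ?linearD //= !lE.
- rewrite (phiE m _ (a *: l x)); last by rewrite linearZ /= lE.
  by rewrite /phi tens_balanced.
have hp : h \o tmap M p =1 coker_pi (tmap M d).
  by apply: eq_tensor_linear => m x /=; rewrite tmapE hE; apply: phiE.
by apply/coker_pi_eq0; rewrite -hp /= pz0 linear0.
Qed.

(** Composed with the functionals of a dual basis of [P], this map yields coordinates in [M] on
    [tensor M P]. *)
Lemma tensor_regular :
  exists mu : {linear tensor M A^o -> M},
    forall m (a : A), mu (tens m (a : A^o)) = ract m a.
Proof.
case: (@tens_univ _ _ M A^o _ (fun m a => ract m a)) => [a b m m'|m|m a a'|h [hE _]].
- by rewrite ractDl scale_ract.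
- by move=> a a'; exact: ractDr.
- by rewrite -ractA.
by exists h.
Qed.

End TensorFacts.

(* The differential with its target index given only up to provable equality,
   which absorbs all transports along identities of integers. *)
Definition diff_to (R : pzRingType) (P : complex R) (i j : int) (e : i + 1 = j) :
    {linear P i -> P j} :=
  match e in _ = j return {linear P i -> P j} with erefl => diff P i end.

(** * Shifts of complexes *)

Section ComplexFacts.
Variables (R : pzRingType) (P : complex R).
Implicit Types i j k : int.

Lemma diff_to_diff_to i j k (e : i + 1 = j) (e' : j + 1 = k) x :
  diff_to P e' (diff_to P e x) = 0.
Proof. by case: k / e'; case: j / e; apply: diff_diff. Qed.

Lemma acyclic_diff_to i j k (e : i + 1 = j) (e' : j + 1 = k) x :
  acyclic P -> diff_to P e' x = 0 -> exists y, diff_to P e y = x.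
Proof. by move=> P_ac; case: k / e'; case: j / e x => x; apply: P_ac. Qed.

Lemma hom_acyclic_diff_to i j k (e : i + 1 = j) (e' : j + 1 = k)
    (X : lmodType R) (phi : {linear P j -> X}) :
  hom_acyclic P X -> (forall x, phi (diff_to P e x) = 0) ->
  exists psi : {linear P k -> X}, forall x, psi (diff_to P e' x) = phi x.
Proof.
by move=> PX; case: k / e'; case: j / e phi => phi; apply: PX.
Qed.

Lemma shift_diff_subproof k i : i + k + 1 = i + 1 + k.
Proof. by rewrite addrAC. Qed.

(** Brings an arbitrary degree to degree [-1], where the Gorenstein-projective cokernel is read
    off. *)
Definition shift_complex (k : int) : complex R :=
  @Complex R (fun i => P (i + k)) (fun i => diff_to P (shift_diff_subproof k i))
    (fun i x => diff_to_diff_to _ _ _).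

Lemma diff_to_shift k i j (e : i + 1 = j) (e' : i + k + 1 = j + k) x :
  diff_to (shift_complex k) e x = diff_to P e' x.
Proof. by case: j / e e' => e'; congr (diff_to P _ x); apply: eq_irrelevance. Qed.

Lemma totally_acyclic_shift k :
  totally_acyclic P -> totally_acyclic (shift_complex k).
Proof.
move=> [P_proj P_ac P_hom]; split=> [i|i x|i phi]; first exact: P_proj.
- exact: acyclic_diff_to.
- exact: hom_acyclic_diff_to.
Qed.

End ComplexFacts.

(** * From vanishing of Ext to acyclicity of Hom *)

Section ExtVanishing.
Variables (R : pzRingType) (P : complex R) (P_tac : totally_acyclic P).

Let G : lmodType R := coker (diff P (- 1)).

Lemma nonpos_diff_subproof (n : nat) : - (n.+1)%:Z + 1 = - n%:Z.
Proof. by rewrite intS opprD addrC addrA subrr sub0r. Qed.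

(** The half of [P] in degrees at most 0, read backwards. It is kept transparent so that its
    differentials reduce to those of [P]. *)
Definition syzygy_resolution : proj_resolution G.
Proof.
apply: (@ProjResolution R G (fun n => P (- n%:Z))
  (fun n => diff_to P (nonpos_diff_subproof n))
  (coker_pi (diff P (- 1)))) => [n|x|x|n x].
- by case: P_tac => /(_ (- n%:Z))[].
- exact: coker_pi_surj.
- rewrite coker_pi_eq0.
  by rewrite (eq_irrelevance (nonpos_diff_subproof 0)
                             (erefl : - 1 + 1 = - 0%:Z :> int)).
- split=> [|[y <-]]; last exact: diff_to_diff_to.
  by case: P_tac => _ P_ac _; apply: acyclic_diff_to.
Defined.

End ExtVanishing.

(** Exactness of [Hom(P, X)] at [P j] is the vanishing of Ext^1 from the cokernel of
    [P j -> P (j + 1)] to [X]. This cokernel is Gorenstein-projective because shifts of [P] are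
    totally acyclic. *)
Lemma gproj_perp_hom_acyclic (R : pzRingType) (P : complex R) (X : lmodType R) :
  totally_acyclic P -> gproj_perp X -> hom_acyclic P X.
Proof.
move=> P_tac [_ X_perp].
(* The degrees are variables tied by equations, so that rewriting exhibits [j] as degree [-1] of the
   complex shifted by [k]. *)
have step (k i j l : int) (e : i + 1 = j) (e' : j + 1 = l)
    (ei : i = - 2 + k) (ej : j = - 1 + k) (el : l = - 0%:Z + k)
    (phi : {linear P j -> X}) : (forall x, phi (diff_to P e x) = 0) ->
    exists psi : {linear P l -> X}, forall x, psi (diff_to P e' x) = phi x.
  move: e e' phi; rewrite ei ej el => e e' phi phi0.
  have Q_tac := totally_acyclic_shift k P_tac.
  have G_gproj : gproj (coker (diff (shift_complex P k) (- 1))).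
    exists (shift_complex P k); split=> //.
    by exists idfun, id.
  case: (X_perp _ G_gproj (syzygy_resolution Q_tac) phi) => [x|psi psiE].
    rewrite -[RHS](phi0 x); congr (phi _).
    exact: (diff_to_shift (nonpos_diff_subproof 1) e).
  exists psi => x; rewrite -psiE; congr (psi _).
  exact: esym (diff_to_shift (nonpos_diff_subproof 0) e' _).
move=> i phi phi0; have := @step (i + 1 + 1) i _ _ erefl erefl _ _ _ phi phi0.
apply; last by rewrite oppr0 add0r.
- by rewrite [RHS]addrC -!addrA [1 + _](_ : _ = 0) ?addr0.
- by rewrite [RHS]addrC addrK.
Qed.

(** * Construction of the twist *)

(** Dependent choice along the integers, in both directions from [-1]; [good] is the invariant that
    allows every further step. *)
Lemma int_dependent_choice (T : int -> Type) (good : forall i, T i -> Prop)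
    (R : forall i j, i + 1 = j -> T i -> T j -> Prop) (x0 : T (- 1)) :
  good _ x0 ->
  (forall i j (e : i + 1 = j) x, good i x -> exists y, R i j e x y /\ good j y) ->
  (forall i j (e : i + 1 = j) y, good j y -> exists x, R i j e x y /\ good i x) ->
  exists x : forall i, T i,
    x (- 1) = x0 /\ forall i j (e : i + 1 = j), R i j e (x i) (x j).
Proof.
move=> good0 fwd bwd.
have eP (n : nat) : n%:Z + 1 = n.+1%:Z by rewrite intS addrC.
have eN (n : nat) : Negz n.+1 + 1 = Negz n.
  by rewrite !NegzE [n.+2%:Z]intS opprD addrC addrA subrr sub0r.
have e0 : (- 1 : int) + 1 = 0%N%:Z by [].
pose next i j e (x : {x : T i | good i x}) : {y : T j | good j y} :=
  let: exist y yP := cid (fwd i j e (sval x) (svalP x)) in exist _ y yP.2.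
pose prev i j e (y : {y : T j | good j y}) : {x : T i | good i x} :=
  let: exist x xP := cid (bwd i j e (sval y) (svalP y)) in exist _ x xP.2.
have nextP i j e x : R i j e (sval x) (sval (next i j e x)).
  by rewrite /next; case: cid => y [].
have prevP i j e y : R i j e (sval (prev i j e y)) (sval y).
  by rewrite /prev; case: cid => x [].
pose s0 : {x : T (- 1) | good _ x} := exist _ x0 good0.
pose pos := nat_rect (fun n : nat => {x : T n%:Z | good _ x}) (next _ _ e0 s0)
  (fun n => next _ _ (eP n)).
(* [Negz n] is [-(n + 1)], so the left half starts at [s0] itself, whereas the right half starts one
   step after it. *)
pose neg := nat_rect (fun n : nat => {x : T (Negz n) | good _ x}) s0
  (fun n => prev _ _ (eN n)).
pose x (i : int) : T i := match i with
  | Posz n => sval (pos n) | Negz n => sval (neg n) end.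
(* The three cases are the right half, the seam from [-1] to [0], and the left half. *)
exists x; split=> // -[n|[|n]] j e.
- have ej := eP n; rewrite e in ej; case: _ / (esym ej) e => e.
  by rewrite (eq_irrelevance e (eP n)); apply: nextP.
- have ej := e0; rewrite e in ej; case: _ / (esym ej) e => e.
  by rewrite (eq_irrelevance e e0); apply: nextP.
- have ej := eN n; rewrite e in ej; case: _ / (esym ej) e => e.
  by rewrite (eq_irrelevance e (eN n)); apply: prevP.
Qed.

(* A horseshoe lemma in both directions: starting in degree [-1], the twist is
   extended to the left by lifting along the exact complex [K] and to the right
   by the acyclicity of [Hom(P, K i)]. *)
Lemma exists_twist (R : pzRingType) (P K : complex R) (X : lmodType R)
    (u : {linear P (- 1 + 1) -> X}) (v : {linear K (- 1 + 1) -> X}) :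
  (forall i, has_dual_basis (P i)) -> acyclic K ->
  (forall i, hom_acyclic P (K i)) ->
  (forall k, v k = 0 -> exists k', diff K (- 1) k' = k) ->
  (forall p, exists k, v k = - u (diff P (- 1) p)) ->
  exists sigma : forall i, {linear P i -> K (i + 1)},
    (forall i p, sigma (i + 1) (diff P i p) + diff K (i + 1) (sigma i p) = 0) /\
    (forall p, u (diff P (- 1) p) + v (sigma (- 1) p) = 0).
Proof.
move=> P_db K_ac PK v_ker uv.
have neg_lin i (W : lmodType R) (h : {linear P i -> W}) :
  linear (fun x => - h x) by move=> a x y; rewrite linearP opprD scalerN.
have [s0 s0E] := dual_basis_lift
  (h := linear_of (neg_lin _ _ (u \o diff P (- 1)))) (P_db _) uv.
(* The invariant: [diff K \o s] kills the image of the incoming differential of [P]. It serves both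
   directions: [- diff K \o s] then extends along [diff P], and [- s \o diff P] takes values in
   cycles of [K]. Quantifying over [h] with [h + 1 = i] avoids subtraction in indices. *)
pose good i (s : {linear P i -> K (i + 1)}) :=
  forall h (e : h + 1 = i) z, diff K (i + 1) (s (diff_to P e z)) = 0.
pose rel i j (e : i + 1 = j) (s : {linear P i -> K (i + 1)})
    (s' : {linear P j -> K (j + 1)}) :=
  forall z, s' (diff_to P e z) + diff_to K (congr1 (fun t => t + 1) e) (s z) = 0.
case: (@int_dependent_choice _ good rel s0).
- move=> h e z.
  have /v_ker[k <-] : v (s0 (diff_to P e z)) = 0.
    rewrite s0E /= (_ : diff P (- 1) _ = 0) ?linear0 ?oppr0 //.
    exact: (diff_to_diff_to e erefl).
  exact: diff_diff.
(* To the right: [s'] comes from the acyclicity of [Hom(P, K (i + 1 + 1))]. *)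
- move=> i j e; case: j / e => s s_good.
  have e1 : i - 1 + 1 = i by rewrite subrK.
  case: (hom_acyclic_diff_to (e := e1) erefl
           (phi := linear_of (neg_lin _ _ (diff K (i + 1) \o s))) (PK _))
    => [z|s' s'E].
    by rewrite /= s_good oppr0.
  exists s'; split=> [z|h e z]; first by rewrite /= s'E /= addNr.
  have eh : h = i := addIr 1 e.
  move: e z; rewrite eh => e z; rewrite (eq_irrelevance e erefl) s'E /=.
  by rewrite linearN /= diff_diff oppr0.
(* To the left: [s'] is a lift along the exact complex [K]. *)
- move=> i j e; case: j / e => s s_good.
  case: (dual_basis_lift (p := diff K (i + 1))
     (h := linear_of (neg_lin _ _ (s \o diff P i))) (P_db _)) => [z|s' s'E].
    apply: K_ac; rewrite /= linearN /= (s_good _ erefl) oppr0 //.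
  exists s'; split=> [z|h e z]; first by rewrite /= s'E /= addrN.
  rewrite s'E /= (_ : diff P i _ = 0) ?linear0 ?oppr0 //.
  exact: (diff_to_diff_to e erefl).
move=> sigma [sigma0 sigmaR]; exists sigma; split=> [i p|p].
  exact: (sigmaR _ _ erefl).
by rewrite sigma0 s0E /= addrN.
Qed.

(** * Acyclicity of Hom into tensor products and extensions *)

Lemma tens_sumr (B A : pzRingType) (M : bimodType B A) (X : lmodType A)
    (I : Type) (r : seq I) (F : I -> X) (m : M) :
  tens m (\sum_(i <- r) F i) = \sum_(i <- r) tens m (F i).
Proof. by apply: (big_morph (tens m)); [apply: tensDr | apply: tens0r]. Qed.

(** Both sides are linear in [z] and agree on pure tensors by balancedness. The formula exhibits
    [tensor M P] as a direct summand of [M^n]. *)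
Lemma tensor_dual_basis (B A : pzRingType) (M : bimodType B A) (P : lmodType A)
    (mu : {linear tensor M A^o -> M}) (n : nat) (e : 'I_n -> P)
    (c : 'I_n -> {linear P -> A^o}) :
  (forall m (a : A), mu (tens m (a : A^o)) = ract m a) ->
  (forall x, x = \sum_(i < n) (c i x : A) *: e i) ->
  forall z, z = \sum_(i < n) tens (mu (tmap M (c i) z)) (e i).
Proof.
move=> muE cE.
have rhs_lin : linear (fun z => \sum_(i < n) tens (mu (tmap M (c i) z)) (e i)).
  move=> b y z; rewrite scaler_sumr -big_split /=; apply: eq_bigr => i _.
  by rewrite !linearP tensDl tensZl.
apply: (eq_tensor_linear (h := idfun) (k := linear_of rhs_lin)) => m x /=.
rewrite {1}(cE x) tens_sumr; apply: eq_bigr => i _.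
by rewrite tmapE muE tens_balanced.
Qed.

(** As [tensor N Q] is a summand of [N^n], the components of [phi] in [N] are extended one at a time
    and then reassembled. *)
Lemma hom_acyclic_tensor (B A : pzRingType) (N : bimodType A B) (P : complex A)
    (Q : lmodType B) :
  hom_acyclic P N -> has_dual_basis Q -> hom_acyclic P (tensor N Q).
Proof.
move=> PN [n [e [c cE]]] i phi phi0.
have [mu muE] := tensor_regular N.
have lift k : exists psi : {linear P (i + 1 + 1) -> N},
    forall x, psi (diff P (i + 1) x) = mu (tmap N (c k) (phi x)).
  have := PN i (mu \o tmap N (c k) \o phi); apply=> x /=.
  by rewrite phi0 !linear0.
have [psi psiE] := choice lift.
have sum_lin : linear (fun x => \sum_(k < n) tens (psi k x) (e k)).
  move=> a x y; rewrite scaler_sumr -big_split /=; apply: eq_bigr => k _.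
  by rewrite linearP tensDl tensZl.
exists (linear_of sum_lin) => x /=; rewrite [RHS](tensor_dual_basis muE cE).
by apply: eq_bigr => k _; rewrite psiE.
Qed.

(** [N] is a summand of its first power; the zero complement is the module of functions on
    ['I_0]. *)
Lemma gproj_perp_self (C D : pzRingType) (N : bimodType C D) :
  (forall W : lmodType C, in_add N W -> gproj_perp W) -> gproj_perp N.
Proof.
apply; exists 1%N, {ffun 'I_0 -> N}.
pose h (w : N * {ffun 'I_0 -> N}) : {ffun 'I_1 -> N} := [ffun=> w.1].
have h_lin : linear h by move=> a x y; apply/ffunP => i; rewrite !ffunE.
exists (linear_of h_lin), (fun w : {ffun 'I_1 -> N} => (w ord0, 0)) => [[x w]|w] /=.
  by congr (_, _); rewrite ?ffunE //; apply/ffunP => -[].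
by apply/ffunP => i; rewrite ffunE /= (ord1 i).
Qed.

(** Since the [T i] are projective, [Hom(T, -)] turns the extension into a short exact sequence of
    complexes, whose middle term is acyclic when the outer ones are. *)
Lemma hom_acyclic_extension (R : pzRingType) (T : complex R) (K U C : lmodType R)
    (k : {linear K -> U}) (p : {linear U -> C}) :
  (forall i, projective (T i)) -> injective k -> (forall y, exists x, p x = y) ->
  (forall x, p x = 0 <-> exists y, k y = x) ->
  hom_acyclic T K -> hom_acyclic T C -> hom_acyclic T U.
Proof.
move=> T_proj k_inj p_surj p_ker TK TC i phi phi0.
case: (TC i (p \o phi)) => [x|c cE]; first by rewrite /= phi0 linear0.
(* The lift [c'] of [c] solves the problem modulo [K]; the defect [phi - c' \o diff T] factors
   through [k] as [l], and [l] is again a cocycle. *)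
have [c' c'E] := T_proj _ _ _ p c p_surj.
have l_ex x : exists y, k y = phi x - c' (diff T (i + 1) x).
  apply/p_ker.
  by rewrite linearB /= c'E cE /= subrr.
have [l lE] := choice l_ex.
have l_lin : linear l.
  move=> a x y; apply: k_inj; rewrite linearP !lE !linearP /=.
  by rewrite scalerDr addrACA.
case: (TK i (linear_of l_lin)) => [x|b bE].
  by apply: k_inj; rewrite /= lE phi0 diff_diff !linear0 addr0.
have sum_lin : linear (fun x => k (b x) + c' x).
  by move=> a x y; rewrite !linearP /= scalerDr addrACA.
by exists (linear_of sum_lin) => x; rewrite /= bE /= lE subrK.
Qed.

(** * Modules over the Morita ring and the induced projectives *)

Section MoritaModuleFacts.
Variables (A B : pzRingType) (N : bimodType A B) (M : bimodType B A).

Lemma morita_addE (l l' : (morita N M)^o) :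
  l + l' = (l.1.1.1 + l'.1.1.1, l.1.1.2 + l'.1.1.2, l.1.2 + l'.1.2, l.2 + l'.2).
Proof. by []. Qed.

Lemma morita_module_scaleE (X : lmodType A) (Y : lmodType B)
    (f : {linear tensor M X -> Y}) (g : {linear tensor N Y -> X})
    (h : morita_compat f g) (l : morita N M) (w : morita_module h) :
  l *: w = (l.1.1.1 *: w.1 + g (tens l.1.1.2 w.2),
            l.2 *: w.2 + f (tens l.1.2 w.1)) :> morita_module h.
Proof. by case: l w => [[[a n] m] b] [x y]. Qed.

Lemma morita_module_linear (X X' : lmodType A) (Y Y' : lmodType B)
    (f : {linear tensor M X -> Y}) (g : {linear tensor N Y -> X})
    (f' : {linear tensor M X' -> Y'}) (g' : {linear tensor N Y' -> X'})
    (h : morita_compat f g) (h' : morita_compat f' g')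
    (al : {linear X -> X'}) (be : {linear Y -> Y'}) :
  (forall m x, be (f (tens m x)) = f' (tens m (al x))) ->
  (forall n y, al (g (tens n y)) = g' (tens n (be y))) ->
  linear (fun w : morita_module h => (al w.1, be w.2) : morita_module h').
Proof.
move=> fE gE l w w'; rewrite !morita_module_scaleE /=.
rewrite [RHS]/GRing.add /= /add_pair /= !linearD /= !linearZ /=.
by rewrite fE gE.
Qed.

Lemma morita_compat0 (X : lmodType A) (Y : lmodType B) :
  morita_compat (\0 : {linear tensor M X -> Y}) (\0 : {linear tensor N Y -> X}).
Proof. by []. Qed.

Section Induced.
Variables (P : lmodType A) (Q : lmodType B).

(** This structure map is the identity on [M (x) P] and zero on [M (x) (N (x) Q)]. *)
Lemma induced_f_linear :
  linear (fun z : tensor M (P * tensor N Q)%type =>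
            (0, tmap M fst z) : (Q * tensor M P)%type).
Proof.
move=> a x y; rewrite linearP [RHS]/GRing.add /= /add_pair /=.
by rewrite scaler0 addr0.
Qed.

Lemma induced_g_linear :
  linear (fun z : tensor N (Q * tensor M P)%type =>
            (0, tmap N fst z) : (P * tensor N Q)%type).
Proof.
move=> a x y; rewrite linearP [RHS]/GRing.add /= /add_pair /=.
by rewrite scaler0 addr0.
Qed.

Lemma induced_compat :
  morita_compat (linear_of induced_f_linear) (linear_of induced_g_linear).
Proof.
by split=> z /=; rewrite tmap_comp tmap0.
Qed.

(* The module [(P, M (x) P, id, 0) (+) (N (x) Q, Q, 0, id)]. *)
Definition induced : lmodType (morita N M) := morita_module induced_compat.

Lemma induced_scaleE (l : morita N M) (w : induced) :
  l *: w = ((l.1.1.1 *: w.1.1, l.1.1.1 *: w.1.2 + tens l.1.1.2 w.2.1),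
            (l.2 *: w.2.1, l.2 *: w.2.2 + tens l.1.2 w.1.1)) :> induced.
Proof.
case: w => [[p z] [q w]]; rewrite morita_module_scaleE /= !tmapE.
by congr (_, _); rewrite [LHS]/GRing.add /= /add_pair /= addr0.
Qed.

Lemma induced_addE (w w' : induced) :
  w + w' = ((w.1.1 + w'.1.1, w.1.2 + w'.1.2), (w.2.1 + w'.2.1, w.2.2 + w'.2.2)).
Proof. by []. Qed.

Lemma induced_sum (I : Type) (r : seq I) (x1 : I -> P) (x2 : I -> tensor N Q)
    (y1 : I -> Q) (y2 : I -> tensor M P) :
  \sum_(i <- r) (((x1 i, x2 i), (y1 i, y2 i)) : induced) =
  ((\sum_(i <- r) x1 i, \sum_(i <- r) x2 i),
   (\sum_(i <- r) y1 i, \sum_(i <- r) y2 i)).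
Proof. by elim: r => [|i r IHr]; rewrite ?big_nil // !big_cons IHr. Qed.

Lemma induced_dual_basis :
  has_dual_basis P -> has_dual_basis Q -> has_dual_basis induced.
Proof.
move=> [n [e [c cE]]] [n' [e' [c' c'E]]].
have [mu muE] := tensor_regular M.
have [nu nuE] := tensor_regular N.
(* The functionals [F i] take values in the first column of the matrices and [F' j] in the second;
   [mu] and [nu] extend the coordinates to the tensor summands. *)
pose F i (w : induced) : (morita N M)^o :=
  (c i w.1.1 : A, 0, mu (tmap M (c i) w.2.2), 0).
pose F' j (w : induced) : (morita N M)^o :=
  (0, nu (tmap N (c' j) w.1.2), 0, c' j w.2.1 : B).
have F_lin i : linear (F i).
  move=> [[[a k] m] b] w w'; rewrite induced_scaleE /F /=.
  rewrite !linearD /= !linearZ /= tmapE muE.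
  rewrite [RHS]morita_addE /= ract0r scaler0 mulr0 !addr0.
  by rewrite [ract _ _ + _]addrC.
have F'_lin j : linear (F' j).
  move=> [[[a k] m] b] w w'; rewrite induced_scaleE /F' /=.
  rewrite !linearD /= !linearZ /= tmapE nuE.
  by rewrite [RHS]morita_addE /= ract0r scaler0 mulr0 !addr0.
exists (n + n')%N.
exists (fun k => match split k with
  | inl i => ((e i, 0), 0) | inr j => (0, (e' j, 0)) end).
exists (fun k => match split k with
  | inl i => linear_of (F_lin i) | inr j => linear_of (F'_lin j) end).
move=> w; rewrite big_split_ord /=.
have sl i : split (lshift n' i) = inl i := unsplitK (inl i).
have sr j : split (rshift n j) = inr j := unsplitK (inr j).
under eq_bigr => i _ do rewrite sl.
under [X in _ + X]eq_bigr => j _ do rewrite sr.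
under eq_bigr => i _ do rewrite induced_scaleE /= !scaler0 !tens0r !addr0 add0r.
under [X in _ + X]eq_bigr => j _ do
  rewrite induced_scaleE /= !scaler0 !tens0r !addr0 add0r.
rewrite !induced_sum !big1_eq induced_addE /= !addr0 !add0r -cE -c'E.
rewrite -(tensor_dual_basis muE cE) -(tensor_dual_basis nuE c'E).
by case: w => [[p z] [q w]].
Qed.

End Induced.
End MoritaModuleFacts.

(** * The twisted complex and its total acyclicity *)

Section TwistedComplex.
Variables (A B : pzRingType) (N : bimodType A B) (M : bimodType B A).

Lemma twisted_map_linear (C D : pzRingType) (K : bimodType C D)
    (P P' : lmodType C) (Q Q' : lmodType D) (d : {linear P -> P'})
    (d' : {linear Q -> Q'}) (sigma : {linear P -> tensor K Q'}) :
  linear (fun x : (P * tensor K Q)%type =>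
            (d x.1, tmap K d' x.2 + sigma x.1) : (P' * tensor K Q')%type).
Proof.
move=> a x y; rewrite [RHS]/GRing.add /= /add_pair /= !linearP /=.
by rewrite scalerDr addrACA.
Qed.

Lemma induced_map_linear (P P' : lmodType A) (Q Q' : lmodType B)
    (d : {linear P -> P'}) (d' : {linear Q -> Q'})
    (sigma : {linear P -> tensor N Q'}) (tau : {linear Q -> tensor M P'}) :
  linear (fun w : induced N M P Q =>
    ((d w.1.1, tmap N d' w.1.2 + sigma w.1.1),
     (d' w.2.1, tmap M d w.2.2 + tau w.2.1)) : induced N M P' Q').
Proof.
apply: (@morita_module_linear _ _ _ _ _ _ _ _ _ _ _ _ _ _
  (linear_of (twisted_map_linear d d' sigma))
  (linear_of (twisted_map_linear d' d tau))) => [m x|n y] /=;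
  by rewrite !tmapE !linear0 addr0.
Qed.

Variables (P : complex A) (Q : complex B).
Variable sigma : forall i, {linear P i -> tensor N (Q (i + 1))}.
Variable tau : forall i, {linear Q i -> tensor M (P (i + 1))}.
Hypothesis sigmaP : forall i p,
  sigma (i + 1) (diff P i p) + tmap N (diff Q (i + 1)) (sigma i p) = 0.
Hypothesis tauP : forall i q,
  tau (i + 1) (diff Q i q) + tmap M (diff P (i + 1)) (tau i q) = 0.

Let T_obj i : lmodType (morita N M) := induced N M (P i) (Q i).
Let T_diff i : {linear T_obj i -> T_obj (i + 1)} :=
  linear_of (induced_map_linear (diff P i) (diff Q i) (sigma i) (tau i)).

Lemma twisted_diff_diff i x : T_diff (i + 1) (T_diff i x) = 0.
Proof.
case: x => [[p z] [q w]]; rewrite /= !diff_diff !linearD /=.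
rewrite !tmap_diff_diff !add0r.
by rewrite [_ + sigma _ _]addrC sigmaP [_ + tau _ _]addrC tauP.
Qed.

Definition twisted_complex : complex (morita N M) := Complex twisted_diff_diff.

Lemma acyclic_twisted :
  acyclic P -> acyclic Q -> acyclic (tensor_complex N Q) ->
  acyclic (tensor_complex M P) -> acyclic twisted_complex.
Proof.
move=> P_ac Q_ac NQ_ac MP_ac i [[p z] [q w]] [] /= dp0 dz0 dq0 dw0.
have cancel (V : zmodType) (x y t : V) : x + y = 0 -> y + t = 0 -> x - t = 0.
  by move=> /eqP; rewrite addr_eq0 => /eqP-> yt0; rewrite -opprD yt0 oppr0.
have [p' p'E] := P_ac _ _ dp0; have [q' q'E] := Q_ac _ _ dq0.
(* By [sigmaP], subtracting the contribution of [p'] turns [z] into a cycle of [N (x) Q]. *)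
have [z' z'E] : exists z', tmap N (diff Q i) z' = z - sigma i p'.
  apply: NQ_ac; rewrite /= linearB /=; apply: cancel _ (sigmaP p').
  by rewrite p'E.
have [w' w'E] : exists w', tmap M (diff P i) w' = w - tau i q'.
  apply: MP_ac; rewrite /= linearB /=; apply: cancel _ (tauP q').
  by rewrite q'E.
exists ((p', z'), (q', w')).
by rewrite /= p'E q'E z'E w'E !subrK.
Qed.

(** A map into a module with zero structure maps kills [N (x) Q] and [M (x) P]. Hence it amounts to
    a pair of maps on [P] and [Q], and the twists disappear. *)
Lemma hom_acyclic_twisted0 (V : lmodType A) (V' : lmodType B) :
  hom_acyclic P V -> hom_acyclic Q V' ->
  hom_acyclic twisted_complex (morita_module (morita_compat0 N M V V')).
Proof.
move=> PV QV' i phi phi0.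
set E := morita_module _ in phi phi0 *.
pose mor a n m b : morita N M := (a, n, m, b).
pose i1 p : twisted_complex (i + 1) := ((p, 0), (0, 0)).
pose i2 q : twisted_complex (i + 1) := ((0, 0), (q, 0)).
have in1_lin : linear (fun p => (phi (i1 p)).1 : V).
  move=> a p p'; have -> : i1 (a *: p + p') = mor a 0 0 0 *: i1 p + i1 p'.
    by rewrite induced_scaleE induced_addE /= !scaler0 !tens0l !add0r.
  by rewrite linearP /= morita_module_scaleE /= addr0.
have in2_lin : linear (fun q => (phi (i2 q)).2 : V').
  move=> b q q'; have -> : i2 (b *: q + q') = mor 0 0 0 b *: i2 q + i2 q'.
    by rewrite induced_scaleE induced_addE /= !scaler0 !tens0l !add0r.
  by rewrite linearP /= morita_module_scaleE /= addr0.
(* The diagonal idempotents fix [i1 p] and [i2 q], so their images lie in the matching component. *)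
have in1_2 p : (phi (i1 p)).2 = 0.
  have -> : i1 p = mor 1 0 0 0 *: i1 p.
    by rewrite induced_scaleE /= !scale1r !scale0r !tens0l !addr0.
  by rewrite linearZ /= morita_module_scaleE /= scale0r addr0.
have in2_1 q : (phi (i2 q)).1 = 0.
  have -> : i2 q = mor 0 0 0 1 *: i2 q.
    by rewrite induced_scaleE /= !scale1r !scale0r !tens0l !addr0.
  by rewrite linearZ /= morita_module_scaleE /= scale0r addr0.
(* The pure tensor of [n] and [q] is the matrix [n] applied to [i2 q], and off-diagonal matrices act
   as zero on [E]. *)
have phi_z z : phi ((0, z), (0, 0)) = 0.
  elim/tens_ind: z => [|n q z IHz]; first exact: linear0.
  have -> : ((0, tens n q + z), (0, 0)) =
      mor 0 n 0 0 *: i2 q + ((0, z), (0, 0)) :> twisted_complex (i + 1).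
    by rewrite induced_scaleE induced_addE /= !scale0r !tens0r !add0r.
  by rewrite linearP /= IHz morita_module_scaleE /= !scale0r !addr0.
have phi_w w : phi ((0, 0), (0, w)) = 0.
  elim/tens_ind: w => [|m p w IHw]; first exact: linear0.
  have -> : ((0, 0), (0, tens m p + w)) =
      mor 0 0 m 0 *: i1 p + ((0, 0), (0, w)) :> twisted_complex (i + 1).
    by rewrite induced_scaleE induced_addE /= !scale0r !tens0r !add0r.
  by rewrite linearP /= IHw morita_module_scaleE /= !scale0r !addr0.
have phiE w : phi w = ((phi (i1 w.1.1)).1, (phi (i2 w.2.1)).2).
  have wE : w = i1 w.1.1 + ((0, w.1.2), (0, 0)) + (i2 w.2.1 + ((0, 0), (0, w.2.2))).
    rewrite !induced_addE /= !addr0 !add0r.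
    by case: w => [[p z] [q w]].
  rewrite [in LHS]wE !linearD /= phi_z phi_w !addr0 [LHS]/GRing.add /= /add_pair /=.
  by rewrite in1_2 in2_1 addr0 add0r.
have [al alE] : exists al : {linear P (i + 1 + 1) -> V},
    forall p, al (diff P (i + 1) p) = linear_of in1_lin p.
  apply: PV => p; have := congr1 fst (phi0 (((p, 0), (0, 0)))).
  by rewrite phiE.
have [be beE] : exists be : {linear Q (i + 1 + 1) -> V'},
    forall q, be (diff Q (i + 1) q) = linear_of in2_lin q.
  apply: QV' => q; have := congr1 snd (phi0 (((0, 0), (q, 0)))).
  by rewrite phiE.
have psi_lin : linear (fun w : twisted_complex (i + 1 + 1) =>
    (al w.1.1, be w.2.1) : E).
  apply: (@morita_module_linear _ _ _ _ _ _ _ _ _ _ _ _ _ _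
    (al \o fst) (be \o fst)) => [m x|n y] /=;
  by rewrite linear0.
by exists (linear_of psi_lin) => w; rewrite /= alE beE [RHS]phiE.
Qed.

Hypothesis P_db : forall i, has_dual_basis (P i).
Hypothesis Q_db : forall i, has_dual_basis (Q i).

Lemma hom_acyclic_twisted_regular :
  hom_acyclic P A^o -> hom_acyclic P N -> hom_acyclic Q B^o -> hom_acyclic Q M ->
  hom_acyclic twisted_complex (morita N M)^o.
Proof.
move=> PA PN QB QM.
(* [E] is the ideal of off-diagonal matrices and [C] the quotient by it. Products of two
   off-diagonal matrices vanish, so both have zero structure maps. *)
pose E := morita_module (morita_compat0 N M N M).
pose C := morita_module (morita_compat0 N M A^o B^o).
have k_lin : linear (fun w : E => (0, w.1, w.2, 0) : (morita N M)^o).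
  move=> [[[a n] m] b] w w'; rewrite morita_module_scaleE.
  rewrite [RHS]morita_addE /= !addr0 ract0r.
  by rewrite [ract _ _ + _](_ : _ = b *: w.2) ?mulr0 ?addr0 ?ract0r ?add0r.
have p_lin : linear (fun l : (morita N M)^o => (l.1.1.1, l.2) : C).
  move=> [[[a n] m] b] [[[a' n'] m'] b'] [[[a'' n''] m''] b''].
  by rewrite morita_module_scaleE /= !addr0.
apply: (hom_acyclic_extension (k := linear_of k_lin) (p := linear_of p_lin)).
- by move=> i; apply/dual_basis_projective/induced_dual_basis.
- by move=> [x y] [x' y'] [-> ->].
- by move=> [a b]; exists (a, 0, 0, b).
- move=> [[[a n] m] b]; split=> [[/= -> ->]|[w <-] //].
  by exists (n, m).
- exact: hom_acyclic_twisted0.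
- exact: hom_acyclic_twisted0.
Qed.

End TwistedComplex.

(** * Resolving the two extensions and assembling the result *)

Lemma complex_proj_dual_basis (R : pzRingType) (P : complex R) :
  complex_proj P -> forall i, has_dual_basis (P i).
Proof. by move=> P_proj i; case: (P_proj i); apply: fg_projective_dual_basis. Qed.

(** The horseshoe for one extension: [u] lifts [p] along [pi], and [s \o tmap N q] is the
    augmentation of the complex [N (x) Q]. Exchanging [P] and [Q] gives the other extension. *)
Lemma extension_twist (A B : pzRingType) (N : bimodType A B)
    (P : complex A) (Q : complex B) (W X : lmodType A) (Z : lmodType B)
    (p : {linear P (- 1 + 1) -> W}) (q : {linear Q (- 1 + 1) -> Z})
    (s : {linear tensor N Z -> X}) (pi : {linear X -> W}) :
  gproj_perp N -> tensor_preserves_acyclic N ->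
  totally_acyclic P -> (forall x, p (diff P (- 1) x) = 0) ->
  totally_acyclic Q -> (forall z, exists y, q y = z) ->
  (forall y, q y = 0 <-> exists x, diff Q (- 1) x = y) ->
  injective s -> (forall w, exists x, pi x = w) ->
  (forall x, pi x = 0 <-> exists z, s z = x) ->
  exists (sigma : forall i, {linear P i -> tensor N (Q (i + 1))})
         (u : {linear P (- 1 + 1) -> X}),
    [/\ forall i x, sigma (i + 1) (diff P i x)
                    + tmap N (diff Q (i + 1)) (sigma i x) = 0,
        forall x, u (diff P (- 1) x) + s (tmap N q (sigma (- 1) x)) = 0
      & forall x, pi (u x) = p x].
Proof.
move=> N_perp N_ac P_tac pd Q_tac q_surj q_ker s_inj pi_surj pi_ker.
have [P_proj P_ac P_hom] := P_tac; have [Q_proj Q_ac Q_hom] := Q_tac.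
have P_db := complex_proj_dual_basis P_proj.
have Q_db := complex_proj_dual_basis Q_proj.
have [u uE] := dual_basis_lift (p := pi) (h := p) (P_db _) (fun x => pi_surj _).
case: (@exists_twist A P (tensor_complex N Q) X u (s \o tmap N q) P_db).
- exact: N_ac.
- by move=> i; apply: hom_acyclic_tensor (Q_db i); apply: gproj_perp_hom_acyclic.
- move=> k /= sk0; apply/(tmap_right_exact q_surj q_ker).
  by apply: s_inj; rewrite sk0 linear0.
- move=> x; have /pi_ker[z zE] : pi (- u (diff P (- 1) x)) = 0.
    by rewrite linearN /= uE pd oppr0.
  by have [k kE] := tmap_surj q_surj z; exists k; rewrite /= kE.
by move=> sigma [sigmaP sigma_u]; exists sigma, u.
Qed.

(* [X] is the cokernel of the twisted differential in degree [-1]. *)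
Lemma twisted_coker (A B : pzRingType) (N : bimodType A B)
    (P P' : lmodType A) (Q Q' : lmodType B) (W X : lmodType A) (Z : lmodType B)
    (d : {linear P' -> P}) (d' : {linear Q' -> Q})
    (sigma : {linear P' -> tensor N Q})
    (p : {linear P -> W}) (q : {linear Q -> Z})
    (s : {linear tensor N Z -> X}) (pi : {linear X -> W}) (u : {linear P -> X}) :
  (forall w, exists x, p x = w) -> (forall x, p x = 0 <-> exists y, d y = x) ->
  (forall z, exists y, q y = z) -> (forall y, q y = 0 <-> exists x, d' x = y) ->
  injective s -> (forall x, pi x = 0 <-> exists z, s z = x) ->
  (forall x, u (d x) + s (tmap N q (sigma x)) = 0) ->
  (forall x, pi (u x) = p x) ->
  (forall x, exists y z, u y + s (tmap N q z) = x) /\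
  (forall y z, u y + s (tmap N q z) = 0 <->
     exists y' z', d y' = y /\ tmap N d' z' + sigma y' = z).
Proof.
move=> p_surj p_ker q_surj q_ker s_inj pi_ker ud uE.
have pis z : pi (s z) = 0 by apply/pi_ker; exists z.
split=> [x|y z].
  have [y yE] := p_surj (pi x).
  have /pi_ker[z zE] : pi (x - u y) = 0 by rewrite linearB /= uE yE subrr.
  have [z' z'E] := tmap_surj q_surj z.
  by exists y, z'; rewrite z'E zE addrC subrK.
split=> [yz0|[y' [z' [<- <-]]]]; last first.
  have /(tmap_right_exact q_surj q_ker) qd :
    exists t, tmap N d' t = tmap N d' z' by exists z'.
  by rewrite !linearD /= qd linear0 add0r ud.
(* Applying [pi] isolates [y]; once [y'] is found, injectivity of [s] shows that [z - sigma y'] dies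
   under [tmap N q]. *)
have /p_ker[y' y'E] : p y = 0.
  by have := congr1 pi yz0; rewrite linearD /= pis addr0 uE linear0.
have /(tmap_right_exact q_surj q_ker)[z' z'E] : tmap N q (z - sigma y') = 0.
  apply: s_inj; rewrite !linearB linear0 /=; apply/eqP; rewrite subr_eq0; apply/eqP.
  by apply: (addrI (u y)); rewrite yz0 -y'E ud.
by exists y', z'; rewrite z'E subrK.
Qed.

(** Stated for short exact sequences instead of literal cokernels, which makes it symmetric in [W]
    and [Z]. *)
Lemma gproj_morita_module (A B : pzRingType) (N : bimodType A B) (M : bimodType B A)
    (W X : lmodType A) (Z Y : lmodType B)
    (s : {linear tensor N Z -> X}) (piX : {linear X -> W})
    (t : {linear tensor M W -> Y}) (piY : {linear Y -> Z}) :
  tensor_preserves_acyclic M -> gproj_perp N ->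
  tensor_preserves_acyclic N -> gproj_perp M ->
  gproj W -> gproj Z ->
  injective s -> (forall w, exists x, piX x = w) ->
  (forall x, piX x = 0 <-> exists z, s z = x) ->
  injective t -> (forall z, exists y, piY y = z) ->
  (forall y, piY y = 0 <-> exists w, t w = y) ->
  exists h : morita_compat (t \o tmap M piX) (s \o tmap N piY),
    gproj (morita_module h).
Proof.
move=> M_ac N_perp N_ac M_perp W_gp Z_gp s_inj piX_surj piX_ker.
move=> t_inj piY_surj piY_ker.
have piXs z : piX (s z) = 0 by apply/piX_ker; exists z.
have piYt w : piY (t w) = 0 by apply/piY_ker; exists w.
have h : morita_compat (t \o tmap M piX) (s \o tmap N piY).
  split=> z /=; rewrite tmap_comp tmap0 ?linear0 // => x /=.
    exact: piYt.
  exact: piXs.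
exists h.
have [P [p [P_tac p_surj p_ker]]] := gproj_resolution W_gp.
have [Q [q [Q_tac q_surj q_ker]]] := gproj_resolution Z_gp.
have pd x : p (diff P (- 1) x) = 0 by apply/p_ker; exists x.
have qd x : q (diff Q (- 1) x) = 0 by apply/q_ker; exists x.
have [sigma [u [sigmaP ud uE]]] :=
  extension_twist N_perp N_ac P_tac pd Q_tac q_surj q_ker s_inj piX_surj piX_ker.
have [tau [v [tauP vd vE]]] :=
  extension_twist M_perp M_ac Q_tac qd P_tac p_surj p_ker t_inj piY_surj piY_ker.
have [P_proj P_ac P_hom] := P_tac; have [Q_proj Q_ac Q_hom] := Q_tac.
have P_db := complex_proj_dual_basis P_proj.
have Q_db := complex_proj_dual_basis Q_proj.
exists (twisted_complex sigmaP tauP); split.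
  split.
  - move=> i; have T_db := induced_dual_basis N M (P_db i) (Q_db i).
    by split; [apply: dual_basis_fin_gen | apply: dual_basis_projective].
  - by apply: acyclic_twisted => //; [apply: N_ac | apply: M_ac].
  - by apply: hom_acyclic_twisted_regular => //; apply: gproj_perp_hom_acyclic.
have [surjX kerX] := twisted_coker p_surj p_ker q_surj q_ker s_inj piX_ker ud uE.
have [surjY kerY] := twisted_coker q_surj q_ker p_surj p_ker t_inj piY_ker vd vE.
have al_lin : linear (fun x : (P (- 1 + 1)%R * tensor N (Q (- 1 + 1)%R))%type =>
    u x.1 + s (tmap N q x.2)).
  by move=> a x y; rewrite /= !linearP /= scalerDr addrACA.
have be_lin : linear (fun y : (Q (- 1 + 1)%R * tensor M (P (- 1 + 1)%R))%type =>
    v y.1 + t (tmap M p y.2)).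
  by move=> a x y; rewrite /= !linearP /= scalerDr addrACA.
(* The augmentation onto [(X, Y, f, g)]. It respects the structure maps because [piX \o u = p] and
   [piX \o s = 0], and likewise for [Y]. *)
have Phi_lin : linear (fun w : induced N M (P (- 1 + 1)) (Q (- 1 + 1)) =>
    (linear_of al_lin w.1, linear_of be_lin w.2) : morita_module h).
  apply: morita_module_linear => [m x|n y] /=.
    by rewrite !tmapE linear0 add0r linearD /= uE piXs addr0.
  by rewrite !tmapE linear0 add0r linearD /= vE piYt addr0.
apply: (coker_isomorphic (p := linear_of Phi_lin)) => [[x y]|[[x z] [y w]]].
  have [x' [z' <-]] := surjX x; have [y' [w' <-]] := surjY y.
  by exists ((x', z'), (y', w')).
split=> [[/= /kerX[x' [z' [<- <-]]] /kerY[y' [w' [<- <-]]]]|[[[x' z'] [y' w']]]].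
  by exists ((x', z'), (y', w')).
case=> <- <- <- <- /=; congr (_, _).
  by apply/kerX; exists x', z'.
by apply/kerY; exists y', w'.
Qed.

(** Handles the cokernel that is identified with [Z] through an isomorphism [e]. *)
Lemma bij_coker_pi_surj (R : pzRingType) (U V Z : lmodType R)
    (d : {linear U -> V}) (e : {linear coker d -> Z}) :
  bijective e -> forall z, exists v, e (coker_pi d v) = z.
Proof.
move=> [e' eK e'K] z; have [v vE] := coker_pi_surj (e' z).
by exists v; rewrite vE e'K.
Qed.

Lemma bij_coker_pi_eq0 (R : pzRingType) (U V Z : lmodType R)
    (d : {linear U -> V}) (e : {linear coker d -> Z}) :
  bijective e -> forall v, e (coker_pi d v) = 0 <-> exists u, d u = v.
Proof.
move=> /bij_inj e_inj v; rewrite -coker_pi_eq0; split=> [ev|->]; last exact: linear0.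
by apply: e_inj; rewrite ev linear0.
Qed.

Theorem theorem3p10 (A B : pzRingType) (N : bimodType A B) (M : bimodType B A)
  (artinL : artin_algebra (morita N M))
  (hyp_i : tensor_preserves_acyclic M)
  (hyp_ii : forall W : lmodType A, in_add N W -> gproj_perp W)
  (hyp_iii : tensor_preserves_acyclic N)
  (hyp_iv : forall W : lmodType B, in_add M W -> gproj_perp W) :
  (* (alpha) *)
  (forall (Z : lmodType B) (X : lmodType A) (Y : lmodType B)
     (s : {linear tensor N Z -> X})
     (t : {linear tensor M (coker s) -> Y})
     (e : {linear coker t -> Z}),
     fin_gen X -> fin_gen Y ->
     gproj Z -> injective s -> gproj (coker s) ->
     injective t -> bijective e ->
     let piX : {linear X -> coker s} := coker_pi s in
     let piY : {linear Y -> Z} := e \o coker_pi t in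
     let f : {linear tensor M X -> Y} := t \o tmap M piX in
     let g : {linear tensor N Y -> X} := s \o tmap N piY in
     exists h : morita_compat f g, gproj (morita_module h))
  /\
  (* (beta) *)
  (forall (Z : lmodType A) (X : lmodType A) (Y : lmodType B)
     (t : {linear tensor M Z -> Y})
     (s : {linear tensor N (coker t) -> X})
     (e : {linear coker s -> Z}),
     fin_gen X -> fin_gen Y ->
     gproj Z -> injective t -> gproj (coker t) ->
     injective s -> bijective e ->
     let piX : {linear X -> Z} := e \o coker_pi s in
     let piY : {linear Y -> coker t} := coker_pi t in
     let f : {linear tensor M X -> Y} := t \o tmap M piX in
     let g : {linear tensor N Y -> X} := s \o tmap N piY in
     exists h : morita_compat f g, gproj (morita_module h)).
Proof.
have N_perp := gproj_perp_self hyp_ii; have M_perp := gproj_perp_self hyp_iv.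
split=> [Z X Y s t e _ _ Z_gp s_inj W_gp t_inj e_bij /=|
         Z X Y t s e _ _ Z_gp t_inj W_gp s_inj e_bij /=].
  apply: gproj_morita_module => //.
  - exact: coker_pi_surj.
  - exact: coker_pi_eq0.
  - exact: bij_coker_pi_surj.
  - exact: bij_coker_pi_eq0.
apply: gproj_morita_module => //.
- exact: bij_coker_pi_surj.
- exact: bij_coker_pi_eq0.
- exact: coker_pi_surj.
- exact: coker_pi_eq0.
Qed.
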